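(* Assume the Model Hypothesis $\mathrm{MH}_{\mathfrak{c}}$. Then: (1) for every sequence $(X_n)_{n\in\omega}$ of first countable Hausdorff spaces, each of size at most $\mathfrak{c}$, the nabla product $\nabla_n X_n$ is hereditarily $D$; (2) and so for every sequence $(X_n)_{n\in\omega}$ of compact, first countable Hausdorff spaces, the box product $\square_n X_n$ is a $D$-space.
   Context: $\mathfrak{c}=2^{\aleph_0}$, and $H(\mathfrak{c})$ is the set of all sets whose transitive closure has cardinality less than $\mathfrak{c}$. The Model Hypothesis $\mathrm{MH}_{\mathfrak{c}}$ is the statement: for some $\kappa$, $H(\mathfrak{c})$ is the increasing union of sets $H_\alpha$, $\alpha<\kappa$, where each $H_\alpha$ is an elementary submodel of $(H(\mathfrak{c}),\in)$ and each $H_\alpha\cap\omega^\omega$ is not $\leq^*$-cofinal in $\omega^\omega$. Here $f\le^* g$ means $f(n)\le g(n)$ for all but finitely many $n$. A neighbornet on a space $(X,\tau)$ is a map $U:X\to\tau$ with $x\in U(x)$ for all $x\in X$. $X$ is a $D$-space if for every neighbornet $U$ on $X$ there is a closed discrete $D\subseteq X$ with $\bigcup_{x\in D}U(x)=X$. A space is hereditarily $D$ if each of its subspaces is a $D$-space. $\square_n X_n$ is the set $\prod_n X_n$ with the topology generated by all sets $\prod_n U_n$ with every $U_n$ open in $X_n$. $\nabla_n X_n$ is the quotient space $(\square_n X_n)/{=^*}$, where $x=^*y$ iff $x(n)=y(n)$ for all but finitely many $n$. *)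

(* Defs.v *)
From HB Require Import structures.
From mathcomp Require Import all_boot wochoice all_classical topology.

Set Implicit Arguments.
Unset Strict Implicit.
Unset Printing Implicit Defensive.

Local Open Scope classical_set_scope.
Local Open Scope card_scope.

(** * The universe of sets *)

(* Aczel's type of well-founded trees: [PSet f] is the set of all [f a].
   Distinct trees may represent the same set; [zfset] identifies them, so that
   Leibniz equality on [zfset] is equality of sets. *)
Inductive pset : Type := PSet (A : Type) (f : A -> pset).

Fixpoint pset_eq (x y : pset) : Prop :=
  match x, y with
  | PSet A f, PSet B g =>
      (forall a, exists b, pset_eq (f a) (g b)) /\
      (forall b, exists a, pset_eq (f a) (g b))
  end.

Definition pset_mem (x y : pset) : Prop :=
  let: PSet B g := y in exists b, pset_eq x (g b).

Lemma pset_eq_refl x : pset_eq x x.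
Proof. by elim: x => A f IH /=; split=> a; exists a; exact: IH. Qed.

Lemma pset_eq_sym x y : pset_eq x y -> pset_eq y x.
Proof.
elim: x y => A f IH [B g] /= [fg gf]; split=> [b|a].
  by have [a /IH] := gf b; exists a.
by have [b /IH] := fg a; exists b.
Qed.

Lemma pset_eq_trans y x z : pset_eq x y -> pset_eq y z -> pset_eq x z.
Proof.
elim: y x z => B g IH [A f] [C h] /= [fg gf] [gh hg]; split=> [a|c].
  by have [b fgab] := fg a; have [c /(IH b _ _ fgab)] := gh b; exists c.
by have [b ghbc] := hg c; have [a /IH/(_ ghbc)] := gf b; exists a.
Qed.

Definition pset_eqb : rel {classic pset} := fun x y => `[< pset_eq x y >].

Lemma pset_eqb_refl : reflexive pset_eqb.
Proof. by move=> x; apply/asboolP; exact: pset_eq_refl. Qed.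

Lemma pset_eqb_sym : symmetric pset_eqb.
Proof. by move=> x y; apply/asboolP/asboolP => /pset_eq_sym. Qed.

Lemma pset_eqb_trans : transitive pset_eqb.
Proof.
move=> y x z /asboolP xy /asboolP yz; apply/asboolP.
exact: pset_eq_trans xy yz.
Qed.

Canonical pset_equiv := EquivRel pset_eqb
  pset_eqb_refl pset_eqb_sym pset_eqb_trans.

Definition zfset : Type := {eq_quot pset_equiv}%qT.

Definition pset_class (x : pset) : zfset :=
  (\pi_({eq_quot pset_equiv}%qT) (x : {classic pset}))%qT.

Definition pset_repr (x : zfset) : pset :=
  (repr (x : {eq_quot pset_equiv}))%qT.

Definition zmem (x y : zfset) : Prop := pset_mem (pset_repr x) (pset_repr y).

Lemma pset_reprK x : pset_class (pset_repr x) = x.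
Proof. exact: reprK. Qed.

Lemma pset_classP x y : pset_class x = pset_class y <-> pset_eq x y.
Proof.
split=> [/eqmodP/asboolP //|xy].
by apply/eqmodP/asboolP.
Qed.

Lemma pset_classK x : pset_eq (pset_repr (pset_class x)) x.
Proof. by apply/pset_classP; rewrite pset_reprK. Qed.

Lemma pset_mem_eq x x' y y' :
  pset_eq x x' -> pset_eq y y' -> pset_mem x y -> pset_mem x' y'.
Proof.
case: y y' => [B g] [B' g'] xx' [gg' _] [b xgb]; have [b' gb] := gg' b.
by exists b'; apply: pset_eq_trans gb; apply: pset_eq_trans xgb;
  exact: pset_eq_sym.
Qed.

Lemma zmem_class x y : zmem (pset_class x) (pset_class y) <-> pset_mem x y.
Proof.
have ex := pset_classK x; have ey := pset_classK y.
by split; apply: pset_mem_eq => //; exact: pset_eq_sym.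
Qed.

Lemma zmem_PSet x (A : Type) (f : A -> pset) :
  zmem x (pset_class (PSet f)) <-> exists a, x = pset_class (f a).
Proof.
rewrite -[x]pset_reprK zmem_class; split=> -[a].
  by move=> /pset_classP xfa; exists a.
by move=> /pset_classP xfa; exists a.
Qed.

Lemma zfset_ext x y : (forall z, zmem z x <-> zmem z y) -> x = y.
Proof.
rewrite -[x]pset_reprK -[y]pset_reprK; case: (pset_repr x) => A f.
case: (pset_repr y) => B g xy; apply/pset_classP; split=> [a|b].
  have /xy/zmem_PSet[b] : zmem (pset_class (f a)) (pset_class (PSet f)).
    by apply/zmem_PSet; exists a.
  by move=> /pset_classP fab; exists b.
have /xy/zmem_PSet[a] : zmem (pset_class (g b)) (pset_class (PSet g)).
  by apply/zmem_PSet; exists b.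
by move=> /pset_classP/pset_eq_sym fab; exists a.
Qed.

Definition pempty : pset := PSet (fun i : void => match i with end).

(* x \cup {x} *)
Definition psucc (x : pset) : pset :=
  let: PSet A f := x in
  PSet (fun i : option A => if i is Some a then f a else x).

(* the von Neumann numeral of [n] *)
Definition pnat (n : nat) : pset := iter n psucc pempty.

Definition ppair2 (x y : pset) : pset :=
  PSet (fun b : bool => if b then x else y).

(* the Kuratowski pair {{x}, {x, y}} *)
Definition ppair (x y : pset) : pset := ppair2 (ppair2 x x) (ppair2 x y).

(* the graph of [f], as an element of the universe of sets *)
Definition zfun (f : nat -> nat) : zfset :=
  pset_class (PSet (fun n : nat => ppair (pnat n) (pnat (f n)))).

(** * H(c) *)

Definition ztransitive (A : set zfset) : Prop :=
  forall x y, A x -> zmem y x -> A y.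

Definition trcl (x : zfset) : set zfset :=
  smallest ztransitive [set y | zmem y x].

Definition card_lt T U (A : set T) (B : set U) : Prop :=
  A #<= B /\ ~ (B #<= A).

Definition continuum : set (nat -> bool) := [set: nat -> bool].

Definition Hc : set zfset := [set x | card_lt (trcl x) continuum].

(** * Elementary submodels *)

(* First-order formulas in the language of set theory, with variables named by
   natural numbers. *)
Inductive formula : Type :=
| FMem of nat & nat
| FEq of nat & nat
| FNot of formula
| FAnd of formula & formula
| FEx of nat & formula.

(* [sat M e p]: the structure [(M, \in)] satisfies [p] under the assignment [e],
   which is intended to take its values in [M]. *)
Fixpoint sat (M : set zfset) (e : nat -> zfset) (p : formula) : Prop :=
  match p with
  | FMem i j => zmem (e i) (e j)
  | FEq i j => e i = e j
  | FNot q => ~ sat M e q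
  | FAnd q r => sat M e q /\ sat M e r
  | FEx i q => exists2 x, M x & sat M (fun j => if j == i then x else e j) q
  end.

Definition elementary_submodel (M N : set zfset) : Prop :=
  [/\ M !=set0, M `<=` N &
      forall (p : formula) (e : nat -> zfset), (forall i, M (e i)) ->
        sat M e p <-> sat N e p].

(** * The Model Hypothesis *)

Definition le_star (f g : nat -> nat) : Prop :=
  \forall n \near \oo, (f n <= g n)%N.

Definition le_star_cofinal (F : set (nat -> nat)) : Prop :=
  forall g, exists2 f, F f & le_star g f.

(* The ordinal kappa is represented by a well-ordered type [(K, R)]. *)
Definition model_hypothesis : Prop :=
  exists (K : Type) (R : rel K) (H : K -> set zfset),
    [/\ well_order R,
        forall a b, R a b -> H a `<=` H b,
        \bigcup_(a in [set: K]) H a = Hc,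
        forall a, elementary_submodel (H a) Hc &
        forall a, ~ le_star_cofinal [set f | H a (zfun f)]].

(** * D-spaces *)

Definition neighbornet (X : topologicalType) (U : X -> set X) : Prop :=
  forall x, open (U x) /\ U x x.

Definition closed_discrete (X : topologicalType) (D : set X) : Prop :=
  closed D /\ D `<=` isolated D.

Definition D_space (X : topologicalType) : Prop :=
  forall U : X -> set X, neighbornet U ->
    exists2 D : set X, closed_discrete D & \bigcup_(x in D) U x = [set: X].

(* [set_type A] carries the subspace topology, whereas [subspace A] would be a
   topology on all of [X] in which the points outside [A] are isolated. *)
Definition hereditarily_D (X : topologicalType) : Prop :=
  forall A : set X, D_space (set_type A).

Definition first_countable (X : topologicalType) : Prop :=
  forall x : X, exists B : set (set X),
    [/\ countable B, B `<=` nbhs x &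
        forall A, nbhs x A -> exists2 C, B C & C `<=` A].

(** * Box products and nabla products *)

Definition box_product (X : nat -> topologicalType) : Type := forall n, X n.

Section BoxProduct.
Variable X : nat -> topologicalType.

HB.instance Definition _ := Choice.copy (box_product X) (forall n, X n).

Definition open_family : set (forall n, set (X n)) :=
  [set U | forall n, open (U n)].

Definition box (U : forall n, set (X n)) : set (box_product X) :=
  [set x | forall n, U n (x n)].

Lemma box_cover : \bigcup_(U in open_family) box U = setT.
Proof.
by apply/seteqP; split=> // x _; exists (fun=> setT) => // n; exact: openT.
Qed.

Lemma box_join (U V : forall n, set (X n)) (x : box_product X) :
  open_family U -> open_family V -> box U x -> box V x ->
  exists W, [/\ open_family W, box W x & box W `<=` box U `&` box V].
Proof.
move=> oU oV Ux Vx; exists (fun n => U n `&` V n); split.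
- by move=> n; exact: openI.
- by move=> n; split; [exact: Ux|exact: Vx].
- by move=> y UVy; split=> n; have [] := UVy n.
Qed.

HB.instance Definition _ :=
  isBaseTopological.Build (box_product X) box_cover box_join.

Definition eq_star : rel (box_product X) :=
  fun x y => `[< \forall n \near \oo, x n = y n >].

Lemma eq_star_refl : reflexive eq_star.
Proof. by move=> x; apply/asboolP; near=> n. Unshelve. all: by end_near. Qed.

Lemma eq_star_sym : symmetric eq_star.
Proof.
by move=> x y; apply/asboolP/asboolP; apply: filterS => n ->.
Qed.

Lemma eq_star_trans : transitive eq_star.
Proof.
move=> y x z /asboolP xy /asboolP yz; apply/asboolP.
by apply: filterS2 xy yz => n -> ->.
Qed.

Canonical eq_star_equiv := EquivRel eq_star
  eq_star_refl eq_star_sym eq_star_trans.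

End BoxProduct.

Definition nabla_product (X : nat -> topologicalType) : Type :=
  quotient_topology {eq_quot (eq_star_equiv X)}%qT.

HB.instance Definition _ (X : nat -> topologicalType) :=
  Topological.on (nabla_product X).

(* Main.v *)
Require Import Defs.
From HB Require Import structures.
From mathcomp Require Import all_boot wochoice all_classical topology.

(** The nabla product is an increasing union, along the well-ordered index set
    of the models, of closed discrete sets. Such a space is hereditarily D
    ([hereditarily_D_increasing_union]): at each stage one keeps the points that
    the neighborhoods chosen so far leave uncovered.

    The level of a model M consists of the classes of the points whose codes lie
    in M. To see that it is closed discrete, fix decreasing countable local
    bases in the factors and let s(n, a, b) be an index for which the basic
    neighborhoods of a and b in the n-th factor separate the two points. If x and
    y have their codes in M and differ infinitely often, then M contains a
    function f such that f(k) = s(n, x(n), y(n)) for some n >= k with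
    x(n) <> y(n) ([elementary_separation]). A nondecreasing g not dominated by
    any function of M exceeds f infinitely often, so that x is not in the
    neighborhood of y given by g. A point y outside the level of M is handled by
    passing to a larger model that contains its codes.

    The topologies do not belong to H(c), and the codes have to bring s into M.
    This is where the hypothesis on the size of the factors and the definition of
    H(c) are used. Identify each factor with a set of reals and order the reals so
    that every initial segment has fewer than c elements
    ([small_initial_segments]). The code of x lists, for all n, the values
    s(n, r, x(n)) for r below x(n); since a countable union of sets of size less
    than c has size less than c ([small_bigcup]), this code is in H(c). For two
    points, one of the two codes mentions s(n, x(n), y(n)) for each n with
    x(n) <> y(n), and f is then definable from the codes by a formula with a
    handful of quantifiers.

    For the second part, compact first countable Hausdorff spaces have size at
    most c ([compact_first_countable_card_le]), so their nabla product is a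
    D-space. The quotient map from the box product is closed and its fibres are
    sigma-compact, by the tube lemma [box_tube]. Hence each fibre has a closed
    discrete kernel whose neighborhoods cover a saturated open set
    ([fibre_kernel]), and the D-property pulls back. *)

Set Implicit Arguments.
Unset Strict Implicit.
Unset Printing Implicit Defensive.

Local Open Scope classical_set_scope.
Local Open Scope card_scope.

(** * Cardinals below the continuum *)

Notation real := (nat -> bool).

Definition small T (A : set T) : Prop := card_lt A continuum.

Lemma card_le_inj T U (A : set T) (B : set U) (f : T -> U) :
  (forall x, A x -> B (f x)) ->
  (forall x y, A x -> A y -> f x = f y -> x = y) -> A #<= B.
Proof.
move=> AB finj; have /inj_card_eq fA : {in A &, injective f}.
  by move=> x y /set_mem Ax /set_mem Ay; exact: finj.
apply: card_le_trans (subset_card_le (_ : f @` A `<=` B)).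
  by have := fA; rewrite card_eq_sym => /card_eqPle[].
by move=> _ [x Ax <-]; exact: AB.
Qed.

(** A predicate on a countable type is a real, by transport along an
    enumeration. *)
Lemma card_le_subsets (T : countType) : [set: T -> bool] #<= continuum.
Proof.
pose e (f : T -> bool) : real := fun m => if unpickle m is Some t then f t else false.
apply: (card_le_inj (f := e)) => // f g _ _ efg; apply/funext => t.
by move/(congr1 (fun h => h (pickle t))): efg; rewrite /e pickleK.
Qed.

Lemma small_le T U (A : set T) (B : set U) : A #<= B -> small B -> small A.
Proof.
move=> AB [Bc cB]; split; first exact: card_le_trans AB Bc.
by move=> cA; apply: cB; exact: card_le_trans cA AB.
Qed.

Lemma small_image T U (f : T -> U) (A : set T) : small A -> small (f @` A).
Proof. by apply: small_le; exact: card_image_le. Qed.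

Lemma countable_small T (A : set T) : countable A -> small A.
Proof.
move=> cA; apply: small_le cA _; split.
  apply: (card_le_inj (f := fun n m => n == m)) => // n m _ _.
  by move/(congr1 (fun h => h n)); rewrite eqxx => /esym/eqP.
move=> /pcard_surjP[g gsurj].
have [n _ gn] := gsurj (fun n => ~~ g n n) I.
by move/(congr1 (fun h => h n)): gn; case: (g n n).
Qed.

(** Koenig's theorem for c: its cofinality is uncountable. If countably many
    sets covered the reals, read each real as a sequence of reals; the n-th
    coordinates of the elements of the n-th set do not exhaust the reals, and a
    sequence of missed values is in none of the sets. *)
Lemma small_bigcup T (F : nat -> set T) :
  (forall n, small (F n)) -> small (\bigcup_n F n).
Proof.
move=> sF; split.
  have /choice[h hinj] n : exists f : T -> real, {in F n &, injective f}.
    by have [/pcard_injP] := sF n.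
  have /choice[k kP] x : exists n, (\bigcup_n F n) x -> F n x.
    by have [[n _ Fnx]|] := pselect ((\bigcup_n F n) x); [exists n|exists 0].
  (* x is determined by the index of a set that contains it and by its image
     under the injection of that set *)
  pose e x : nat + nat -> bool := fun i =>
    match i with inl m => m == k x | inr m => h (k x) x m end.
  apply: card_le_trans (@card_le_subsets (nat + nat)%type).
  apply: (card_le_inj (f := e)) => // x y Ux Uy exy.
  have kxy : k x = k y.
    by move/(congr1 (fun f => f (inl (k x)))): exy => /=; rewrite eqxx => /esym/eqP.
  apply: (hinj (k x)); rewrite ?inE; [exact: kP|by rewrite kxy; exact: kP|].
  apply/funext => m.
  by move/(congr1 (fun f => f (inr m))): exy => /=; rewrite -kxy.
move=> /pcard_surjP[g gsurj].
have /choice[y yP] n : exists y : real,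
    forall x, F n x -> (fun m => g x (pickle (n, m))) <> y.
  apply: contrapT => noy; have [_] := sF n; apply; apply/pcard_surjP.
  exists (fun x m => g x (pickle (n, m))) => y _.
  apply: contrapT => yP; apply: noy; exists y => x Fx gy; apply: yP.
  by exists x.
pose r : real := fun i => if unpickle i is Some (n, m) then y n m else false.
have [x [n _ Fnx] gx] := gsurj r I.
apply: (yP n x Fnx); apply/funext => m.
by rewrite gx /r pickleK.
Qed.

Lemma well_order_min K (R : rel K) (A : set K) : well_order R ->
  A !=set0 -> exists2 z, A z & forall x, A x -> R z x.
Proof.
move=> woR [a Aa]; have [|z [[/asboolP Az zmin] _]] := woR (fun x => `[< A x >]).
  by exists a; apply/asboolP.
by exists z => // x Ax; apply: zmin; apply/asboolP.
Qed.

Lemma well_order_total K (R : rel K) x y : well_order R -> R x y \/ R y x.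
Proof.
move=> woR; have [|z [->|->] zmin] := @well_order_min _ R [set x; y] woR.
- by exists x; left.
- by left; apply: zmin; right.
- by right; apply: zmin; left.
Qed.

Lemma well_order_anti K (R : rel K) x y : well_order R -> R x y -> R y x -> x = y.
Proof.
move=> woR xy yx; have Rxx z : R z z by have [] := well_order_total z z woR.
have [|z [_ zuniq]] := woR (fun z => `[< z = x \/ z = y >]).
  by exists x; apply/asboolP; left.
by rewrite -(zuniq x) ?(zuniq y) //; split; rewrite ?unfold_in;
  try (by apply/asboolP; auto); move=> t /asboolP[] ->.
Qed.

Lemma well_order_wf K (R : rel K) : well_order R ->
  well_founded (fun b a => R b a /\ b <> a).
Proof.
move=> woR a; apply: contrapT => nacc.
have [z nz zmin] := well_order_min woR (ex_intro (fun a => ~ Acc _ a) a nacc).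
apply: nz; split=> b [bz neq]; apply: contrapT => nb.
exact: neq (well_order_anti woR bz (zmin _ nb)).
Qed.

(** Among the initial segments of a well-order of the reals, take the least one
    that is not small, if there is any: it has c elements, and the order that it
    induces on a copy of the reals has only small initial segments. *)
Lemma small_initial_segments :
  exists R : real -> real -> Prop,
    [/\ forall r, ~ R r r, forall r s, r <> s -> R r s \/ R s r &
        forall s, small [set r | R r s]].
Proof.
have [R woR] := well_ordering_principle (real : eqType).
pose S r s := R r s /\ r <> s.
have Stot r s : r <> s -> S r s \/ S s r.
  move=> rs; have [rs'|sr] := well_order_total r s woR; first by left.
  by right; split=> // /esym.
have [|] := pselect (forall s, small [set r | S r s]).
  by exists S; split=> // r [].
move=> /existsNP ex; have [m nsm mmin] := well_order_min woR ex.
have smin s : S s m -> small [set r | S r s].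
  move=> [sm neq]; apply: contrapT => nss; apply: neq.
  exact: well_order_anti woR sm (mmin _ nss).
have /pcard_leP[h] : continuum #<= [set r | S r m].
  apply: contrapT => ncm; apply: nsm; split=> //; exact: card_leT.
exists (fun r s => S (h r) (h s)); split=> [r []//|r s rs|s].
  by apply: Stot => hrs; apply: rs; apply: inj hrs; rewrite inE.
apply: small_le (smin (h s) (@funS _ _ _ _ h s I)).
by apply: (card_le_inj (f := h)) => // x y _ _ ; apply: inj; rewrite inE.
Qed.

(** * Sets and H(c) *)

(** The index type is a type of elements of [T], so that only the universe level
    of [T] matters, and not that of [zfset]. *)
Definition zset_of T (A : set T) (f : T -> zfset) : zfset :=
  pset_class (PSet (fun t : {t | A t} => pset_repr (f (sval t)))).

Lemma zmem_set_of T (A : set T) (f : T -> zfset) z :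
  zmem z (zset_of A f) <-> exists2 t, A t & z = f t.
Proof.
rewrite zmem_PSet; split=> [[[t At] /= ->]|[t At ->]].
  by exists t; rewrite ?pset_reprK.
by exists (exist _ t At); rewrite /= pset_reprK.
Qed.

Lemma trcl_mem x z : zmem z x -> trcl x z.
Proof. by move=> zx A [_]; apply. Qed.

Lemma trcl_trans x : ztransitive (trcl x).
Proof. by move=> y z xy zy A [tA xA]; apply: (tA y z) => //; exact: xy. Qed.

Lemma trcl_min x (A : set zfset) :
  ztransitive A -> (forall z, zmem z x -> A z) -> trcl x `<=` A.
Proof. by move=> tA xA z; apply. Qed.

Lemma trcl_bigcup x :
  trcl x `<=` \bigcup_(z in [set z | zmem z x]) ([set z] `|` trcl z).
Proof.
apply: trcl_min => [y w [z zx yz] wy|z zx]; last by exists z => //; left.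
exists z => //; right.
by case: yz => [<-|/trcl_trans]; [exact: trcl_mem|apply].
Qed.

Lemma Hc_trans : ztransitive Hc.
Proof.
move=> x y; rewrite /Hc /= => Hx yx; apply: small_le Hx; apply: subset_card_le.
apply: trcl_min => [|z zy]; first exact: trcl_trans.
exact: trcl_trans (trcl_mem yx) zy.
Qed.

Definition hcountable x : Prop := countable (trcl x).

Lemma hcountable_Hc x : hcountable x -> Hc x.
Proof. exact: countable_small. Qed.

Lemma hcountable_mem x : countable [set z | zmem z x] ->
  (forall z, zmem z x -> hcountable z) -> hcountable x.
Proof.
move=> cx hx; apply: sub_countable (subset_card_le (@trcl_bigcup x)) _.
apply: bigcup_countable => // z /hx hz.
rewrite -bigcup2E; apply: bigcup_countable => [|i _]; first exact: countableP.
by case: i => [|[|i]] //=; exact: countable1.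
Qed.

Lemma countable_range T (A : set T) (x0 : T) : countable A ->
  exists e : nat -> T, A `<=` range e.
Proof.
move=> /countable_injP[f finj].
have /choice[e eP] n : exists x, forall y, A y -> f y = n -> x = y.
  have [[y [Ay <-]]|no] := pselect (exists y, A y /\ f y = n).
    by exists y => z Az fzy; apply: finj; rewrite ?inE.
  by exists x0 => y Ay fyn; case: no; exists y.
by exists e => x Ax; exists (f x) => //; exact: eP.
Qed.

(** Sets with a countable transitive closure serve as the elements of the codes:
    a small set of them is in H(c), whereas for singular c a small set of
    elements of H(c) may fail to be. *)
Lemma Hc_mem x : small [set z | zmem z x] ->
  (forall z, zmem z x -> hcountable z) -> Hc x.
Proof.
move=> sx hx; have /choice[e eP] z : exists e : nat -> zfset,
    zmem z x -> [set z] `|` trcl z `<=` range e.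
  have [/hx hz|] := pselect (zmem z x); last by exists (fun=> z).
  have [|e eP] := @countable_range _ ([set z] `|` trcl z) z; last by exists e.
  rewrite -bigcup2E; apply: bigcup_countable => [|i _]; first exact: countableP.
  by case: i => [|[|i]] //=; exact: countable1.
apply: small_le (small_bigcup (F := fun n => e^~ n @` [set z | zmem z x]) _).
  apply: subset_card_le => y /trcl_bigcup[z zx /(eP z zx)[n _ <-]].
  by exists n => //; exists z.
by move=> n; exact: small_image.
Qed.

Lemma hcountable_set_of T (A : set T) (f : T -> zfset) :
  countable A -> (forall t, A t -> hcountable (f t)) -> hcountable (zset_of A f).
Proof.
move=> cA hf; apply: hcountable_mem => [|z /zmem_set_of[t At ->]]; last exact: hf.
apply: sub_countable cA; apply: card_le_trans (card_image_le f A).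
by apply: subset_card_le => z /zmem_set_of[t At ->]; exists t.
Qed.

Lemma Hc_set_of T (A : set T) (f : T -> zfset) :
  small A -> (forall t, A t -> hcountable (f t)) -> Hc (zset_of A f).
Proof.
move=> sA hf; apply: Hc_mem => [|z /zmem_set_of[t At ->]]; last exact: hf.
apply: small_le (small_image f sA).
by apply: subset_card_le => z /zmem_set_of[t At ->]; exists t.
Qed.

Lemma hcountable_sub x y : (forall z, zmem z x -> zmem z y) ->
  hcountable y -> hcountable x.
Proof.
move=> xy; apply: sub_countable; apply: subset_card_le.
by apply: trcl_min => [|z /xy]; [exact: trcl_trans|exact: trcl_mem].
Qed.

(** * Numerals and pairs *)

Definition zpair2 (a b : zfset) : zfset :=
  pset_class (ppair2 (pset_repr a) (pset_repr b)).

Lemma zmem_ppair2 z x y :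
  zmem z (pset_class (ppair2 x y)) <-> z = pset_class x \/ z = pset_class y.
Proof.
rewrite zmem_PSet; split=> [[[] ->]|[]->]; [by left|by right| |].
  by exists true.
by exists false.
Qed.

Lemma zmem_pair2 z a b : zmem z (zpair2 a b) <-> z = a \/ z = b.
Proof. by rewrite zmem_ppair2 !pset_reprK. Qed.

Lemma class_ppair2 x y :
  pset_class (ppair2 x y) = zpair2 (pset_class x) (pset_class y).
Proof. by apply: zfset_ext => z; rewrite zmem_ppair2 zmem_pair2. Qed.

Lemma zpair2_inj a b c d : zpair2 a b = zpair2 c d ->
  (a = c /\ b = d) \/ (a = d /\ b = c).
Proof.
move=> e; have E z : z = a \/ z = b <-> z = c \/ z = d by rewrite -!zmem_pair2 e.
have := (E a).1 (or_introl erefl); have := (E b).1 (or_intror erefl).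
have := (E c).2 (or_introl erefl); have := (E d).2 (or_intror erefl).
by move=> [->|->] [->|->] [?|?] [?|?]; subst; auto.
Qed.

Lemma hcountable_pair2 a b : hcountable a -> hcountable b -> hcountable (zpair2 a b).
Proof.
move=> ha hb; apply: hcountable_mem => [|z /zmem_pair2[]-> //].
apply: (@sub_countable _ _ _ [set a; b]).
  by apply: subset_card_le => z /zmem_pair2.
by apply: finite_set_countable; exact: finite_set2.
Qed.

Definition znat n : zfset := pset_class (Defs.pnat n).

Lemma zmem_psucc z x :
  zmem z (pset_class (psucc x)) <-> z = pset_class x \/ zmem z (pset_class x).
Proof.
case: x => A f; rewrite /= !zmem_PSet; split=> [[[a|] ->]|[->|[a ->]]].
- by right; exists a.
- by left.
- by exists None.
- by exists (Some a).
Qed.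

Lemma zmem_znat z n : zmem z (znat n) <-> exists2 m, (m < n)%N & z = znat m.
Proof.
elim: n z => [|n IH] z; first by rewrite zmem_PSet; split=> -[].
rewrite zmem_psucc IH; split=> [[->|[m mn ->]]|[m]].
- by exists n.
- by exists m => //; exact: ltnW.
by rewrite ltnS leq_eqVlt => /orP[/eqP->|mn] ->; [left|right; exists m].
Qed.

Lemma zmem_irr z : ~ zmem z z.
Proof.
rewrite /zmem; elim: (pset_repr z) => A f IH [a] e.
apply: (IH a); apply: pset_mem_eq (pset_eq_refl _) e _.
by exists a; exact: pset_eq_refl.
Qed.

Lemma znat_inj : injective znat.
Proof.
move=> m n mn; have [lt|lt|//] := ltngtP m n; exfalso; apply: (@zmem_irr (znat m)).
- by rewrite [X in zmem _ X]mn; apply/zmem_znat; exists m.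
- by rewrite [X in zmem X _]mn; apply/zmem_znat; exists n.
Qed.

Lemma hcountable_znat n : hcountable (znat n).
Proof.
elim: n => [|n IH]; apply: hcountable_mem.
- apply: (@sub_countable _ _ _ (@set0 zfset)); last exact: countable0.
  by apply: subset_card_le => z /zmem_znat[].
- by move=> z /zmem_znat[].
- apply: (@sub_countable _ _ _ (range znat)).
    by apply: subset_card_le => z /zmem_znat[m _ ->]; exists m.
  by apply: sub_countable (card_image_le _ _) _; exact: countableP.
move=> z /zmem_znat[m]; rewrite ltnS => mn ->.
apply: hcountable_sub IH => w /zmem_znat[k km ->]; apply/zmem_znat.
by exists k => //; exact: leq_trans mn.
Qed.

(** The Kuratowski pairs that make up the graphs [zfun f]. *)
Definition zpt (k j : nat) : zfset :=
  zpair2 (zpair2 (znat k) (znat k)) (zpair2 (znat k) (znat j)).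

Lemma zpt_inj k j k' j' : zpt k j = zpt k' j' -> k = k' /\ j = j'.
Proof.
move=> /zpair2_inj[[/zpair2_inj e /zpair2_inj e']|[/zpair2_inj e /zpair2_inj e']].
all: move: e e' => [] [/znat_inj ? /znat_inj ?] [] [/znat_inj ? /znat_inj ?]; subst; auto.
Qed.

Lemma hcountable_zpt k j : hcountable (zpt k j).
Proof. by do !apply: hcountable_pair2; exact: hcountable_znat. Qed.

Lemma zmem_zfun z f : zmem z (zfun f) <-> exists n, z = zpt n (f n).
Proof.
rewrite zmem_PSet; split=> -[n ->]; exists n; by rewrite /ppair !class_ppair2.
Qed.

(** * Definability in elementary submodels of H(c) *)

(** An element of [N] that is definable in [N] from parameters in [M] is in [M]:
    elementarity gives an element of [M] with the same definition, and by
    transitivity of [N] the two are extensionally equal. The variables 0 and 1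
    stand for an element and for the candidate set; the equivalence is required
    under every value [y] of the latter, so that [p] cannot refer to it. *)
Lemma elementary_comprehension (M N : set zfset) (p : formula) (e : nat -> zfset) F :
  ztransitive N -> elementary_submodel M N -> (forall i, M (e i)) -> N F ->
  (forall y z, N y -> N z -> zmem z F <->
    sat N (fun j => if j == 0 then z else if j == 1 then y else e j) p) ->
  M F.
Proof.
move=> tN [_ MN elem] Me NF pF.
(* forall z, z \in v_1 <-> p *)
pose body := FNot (FEx 0 (FNot (FAnd (FNot (FAnd (FMem 0 1) (FNot p)))
                                     (FNot (FAnd p (FNot (FMem 0 1))))))).
have bodyP y : N y -> sat N (fun j => if j == 1 then y else e j) body <->
    forall z, N z -> zmem z y <-> zmem z F.
  move=> Ny /=; split=> [h z Nz|h [z Nz]]; have pz := pF y z Ny Nz.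
    have {}h : ~ ~ (~ (zmem z y /\ ~ zmem z F) /\ ~ (zmem z F /\ ~ zmem z y)).
      by move=> h'; apply: h; exists z => //; rewrite -pz.
    by move/contrapT: h => [h1 h2]; split=> ?; apply: contrapT => ?;
      [apply: h1|apply: h2].
  by have := h z Nz; rewrite -pz => hz; apply; split=> -[]; rewrite hz.
have : sat N e (FEx 1 body) by exists F => //; exact/bodyP.
move=> /(elem _ _ Me)[y My] yP.
have Me' (i : nat) : M (if i == 1 then y else e i) by case: ifP.
have {}yP := (bodyP y (MN y My)).1 ((elem body _ Me').1 yP).
rewrite (_ : F = y) //; apply: zfset_ext => z; split=> [zF|zy].
  by apply/yP => //; exact: tN NF zF.
by apply/yP => //; exact: tN (MN _ My) zy.
Qed.

(** An unordered pair stands for the ordered pair of a code and of a grid point: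
    the two kinds of sets are disjoint ([zcode_zpt]), so that the order can be
    recovered, and the formula needs no decoding of pairs. *)
Definition link (W C z : zfset) : Prop :=
  exists2 p, zmem p W & zmem z p /\ exists2 c, zmem c C & zmem c p.

Lemma elementary_link M W1 C1 W2 C2 P G : elementary_submodel M Hc ->
  M W1 -> M C1 -> M W2 -> M C2 -> M P -> Hc G ->
  (forall z, zmem z G <-> zmem z P /\ (link W1 C1 z \/ link W2 C2 z)) -> M G.
Proof.
move=> elM MW1 MC1 MW2 MC2 MP HG GP.
(* 0 is the candidate element, 8 and 9 are bound *)
pose flink W C := FEx 8 (FAnd (FMem 8 W) (FAnd (FMem 0 8)
                    (FEx 9 (FAnd (FMem 9 C) (FMem 9 8))))).
pose p := FAnd (FMem 0 6)
  (FNot (FAnd (FNot (flink 2 3)) (FNot (flink 4 5)))).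
pose e := nth P [:: P; P; W1; C1; W2; C2].
have Me i : M (e i).
  by rewrite /e; do 6?[case: i => [//|i]]; rewrite /= nth_nil.
have MH x : M x -> Hc x by case: elM => _ + _; apply.
apply: (elementary_comprehension (p := p) Hc_trans elM Me HG) => y z Hy Hz.
have linkP W C : M W -> link W C z <-> exists2 x, Hc x & zmem x W /\ zmem z x /\
    (exists2 x0, Hc x0 & zmem x0 C /\ zmem x0 x).
  move=> /MH HW; split=> [[q qW [zq [c cC cq]]]|[q _ [qW [zq [c _ [cC cq]]]]]].
    have Hq := Hc_trans HW qW; exists q => //; do 2!split=> //.
    by exists c => //; exact: Hc_trans Hq cq.
  by exists q => //; split=> //; exists c.
rewrite GP /p /= -linkP // -linkP //; split=> -[zP H]; split=> //.
  by move=> [h1 h2]; case: H.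
by apply: contrapT => /not_orP[h1 h2]; exact: H.
Qed.

(** For [L] the family of all sets {(k, i) : i <= j}, this set [F] selects from
    each vertical section of the relation [G] its least element. *)
Lemma elementary_cut M G L F : elementary_submodel M Hc ->
  M G -> M L -> Hc F ->
  (forall z, zmem z F <-> exists2 I, zmem I L &
     [/\ zmem z I, zmem z G & forall w, zmem w I -> zmem w G -> w = z]) -> M F.
Proof.
move=> elM MG ML HF FP.
pose p := FEx 4 (FAnd (FMem 4 3) (FAnd (FMem 0 4) (FAnd (FMem 0 2)
  (FNot (FEx 5 (FAnd (FMem 5 4) (FAnd (FMem 5 2) (FNot (FEq 5 0))))))))).
pose e := nth G [:: G; G; G; L].
have Me i : M (e i) by rewrite /e; do 4?[case: i => [//|i]]; rewrite /= nth_nil.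
have MH x : M x -> Hc x by case: elM => _ + _; apply.
apply: (elementary_comprehension (p := p) Hc_trans elM Me HF) => y z Hy Hz.
rewrite FP /=; split=> [[I IL [zI zG Iz]]|[I _ [IL [zI [zG Iz]]]]].
  exists I; first exact: Hc_trans (MH _ ML) IL.
  by do 3!split=> //; move=> [w _ [wI [wG]]]; apply; exact: Iz.
exists I => //; split=> // w wI wG; apply: contrapT => wz; apply: Iz.
by exists w => //; exact: Hc_trans (MH _ MG) wG.
Qed.

Definition zpts : zfset := zset_of [set: nat * nat] (fun t => zpt t.1 t.2).

Definition zcut (k j : nat) : zfset := zset_of [set i | i <= j] (zpt k).

Definition zcuts : zfset := zset_of [set: nat * nat] (fun t => zcut t.1 t.2).

Lemma hcountable_zpts : hcountable zpts.
Proof.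
apply: hcountable_set_of => [|t _]; [exact: countableP|exact: hcountable_zpt].
Qed.

Lemma hcountable_zcuts : hcountable zcuts.
Proof.
apply: hcountable_set_of => [|t _]; first exact: countableP.
apply: hcountable_set_of => [|i _]; [exact: countableP|exact: hcountable_zpt].
Qed.

(** The selector takes the least value in each section; this choice is definable
    from the parameter [zcuts]. *)
Lemma elementary_uniformize M G (A : nat -> nat -> Prop) :
  elementary_submodel M Hc -> M zcuts -> M G ->
  (forall z, zmem z G <-> exists k j, z = zpt k j /\ A k j) ->
  (forall k, exists j, A k j) ->
  exists2 f, M (zfun f) & forall k, A k (f k).
Proof.
move=> elM ML MG GP Aex.
have /choice[f fP] k : exists j, A k j /\ forall i, A k i -> j <= i.
  have [j0 Aj0] := Aex k.
  have ex : exists j, `[< A k j >] by exists j0; apply/asboolP.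
  exists (ex_minn ex); case: ex_minnP => j /asboolP Aj jmin.
  by split=> // i Ai; apply: jmin; apply/asboolP.
have GP' k j : zmem (zpt k j) G <-> A k j.
  rewrite GP; split=> [[k' [j' [/zpt_inj[-> ->]]]] //|Akj].
  by exists k, j.
exists f => [|k]; last by case: (fP k).
have Hf : Hc (zfun f).
  apply/hcountable_Hc/(hcountable_sub _ hcountable_zpts) => z /zmem_zfun[n ->].
  by apply/zmem_set_of; exists (n, f n).
apply: (elementary_cut elM MG ML Hf) => z; rewrite zmem_zfun; split.
  move=> [n ->]; have [Afn fmin] := fP n; exists (zcut n (f n)).
    by apply/zmem_set_of; exists (n, f n).
  split; [by apply/zmem_set_of; exists (f n) => /=|exact/GP'|].
  move=> w /zmem_set_of[i /= ifn ->] /GP' /fmin fi.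
  by congr zpt; apply/eqP; rewrite eqn_leq ifn.
move=> [I /zmem_set_of[[k j] _ -> /=] [/zmem_set_of[i /= ij ->] /GP' Aki zmin]].
have [Afk fmin] := fP k; exists k; apply/esym/zmin; last exact/GP'.
by apply/zmem_set_of; exists (f k) => //=; exact: leq_trans (fmin _ Aki) ij.
Qed.

(** * Codes of sequences *)

(** A hereditarily countable set that determines [n] and [r]. Its elements are
    numerals from 2 on, which have at least two elements; hence it is never a
    Kuratowski pair, as such a pair has a singleton as an element. *)
Definition zcode (n : nat) (r : real) : zfset :=
  zset_of [set t : nat + nat | match t with inl m => m == n | inr m => r m end]
          (fun t => znat (pickle t).+2).

Lemma zmem_zcode n r (t : nat + nat) : zmem (znat (pickle t).+2) (zcode n r) <->
  match t with inl m => m == n | inr m => r m end.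
Proof.
rewrite zmem_set_of; split=> [[t' /= + /znat_inj[]]|]; last by exists t.
by move=> + /(pcan_inj pickleK) => /[swap] <-.
Qed.

Lemma zcode_inj n r n' r' : zcode n r = zcode n' r' -> n = n' /\ r = r'.
Proof.
move=> e; split.
  by have /(zmem_zcode n r (inl n)) := eqxx n; rewrite e => /zmem_zcode/eqP.
apply/funext => m; apply/idP/idP => rm.
  by have /(zmem_zcode n r (inr m)) := rm; rewrite e => /zmem_zcode.
by have /(zmem_zcode n' r' (inr m)) := rm; rewrite -e => /zmem_zcode.
Qed.

Lemma hcountable_zcode n r : hcountable (zcode n r).
Proof.
apply: hcountable_set_of => [|t _]; [exact: countableP|exact: hcountable_znat].
Qed.

Lemma zcode_zpt n r k j : zcode n r <> zpt k j.
Proof.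
move=> e; have /zmem_set_of[t _ at2] : zmem (zpair2 (znat k) (znat k)) (zcode n r).
  by rewrite e; apply/zmem_pair2; left.
have E i : i < 2 -> znat i = znat k.
  move=> i2; suff: zmem (znat i) (zpair2 (znat k) (znat k)) by case/zmem_pair2.
  by rewrite at2; apply/zmem_znat; exists i => //; exact: leq_trans i2 _.
by have := E 0 isT; rewrite -(E 1 isT) => /znat_inj.
Qed.

Section Codes.
Variables (R : real -> real -> Prop) (s : nat -> real -> real -> nat).
Hypothesis R_irr : forall r, ~ R r r.
Hypothesis R_total : forall r t, r <> t -> R r t \/ R t r.
Hypothesis R_small : forall t, small [set r | R r t].
Hypothesis s_sym : forall n r t, s n r t = s n t r.

Definition zseq (u : nat -> real) : zfset :=
  zset_of [set: nat] (fun n => zcode n (u n)).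

(** The values of [s] at the predecessors of the terms of [u]. Pairing the value
    at [n] with every [k <= n], rather than with [n] alone, makes the union of the
    relations read off from two codes total as soon as the two sequences differ
    infinitely often. *)
Definition zbelow (u : nat -> real) : zfset :=
  zset_of [set t : nat * real * nat | R t.1.2 (u t.1.1) /\ t.2 <= t.1.1]
    (fun t => zpair2 (zcode t.1.1 t.1.2) (zpt t.2 (s t.1.1 t.1.2 (u t.1.1)))).

Lemma hcountable_zseq u : hcountable (zseq u).
Proof.
apply: hcountable_set_of => [|n _]; [exact: countableP|exact: hcountable_zcode].
Qed.

(** The union over the countably many pairs [n, k] of sets indexed by the small
    initial segments below [u n]. *)
Lemma Hc_zbelow u : Hc (zbelow u).
Proof.
apply: Hc_set_of => [|t _]; last first.
  by apply: hcountable_pair2; [exact: hcountable_zcode|exact: hcountable_zpt].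
pose F (n : nat) := \bigcup_(k in [set: nat]) (fun r => (n, r, k)) @` [set r | R r (u n)].
have sF : small (\bigcup_n F n).
  by apply: small_bigcup => n; apply: small_bigcup => k; exact: small_image.
apply: small_le sF.
  by apply: subset_card_le => -[[n r] k] /= [Rr kn]; exists n => //;
    exists k => //; exists r.
Qed.

Lemma link_below u v z : zmem z zpts -> link (zbelow u) (zseq v) z <->
  exists n k, [/\ k <= n, R (v n) (u n) & z = zpt k (s n (v n) (u n))].
Proof.
move=> /zmem_set_of[[k0 j0] _ /= ->]; split.
  move=> [_ /zmem_set_of[[[n r] k] /= [Rr kn] ->]].
  move=> [/zmem_pair2[/esym/zcode_zpt//|->] [_ /zmem_set_of[m _ ->]]].
  move=> /zmem_pair2[/zcode_inj[mn vr]|/zcode_zpt//].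
  by exists n, k; rewrite -mn vr mn; split.
move=> [n [k [kn Rvu ->]]].
exists (zpair2 (zcode n (v n)) (zpt k (s n (v n) (u n)))).
  by apply/zmem_set_of; exists (n, v n, k).
split; first by apply/zmem_pair2; right.
by exists (zcode n (v n)); [apply/zmem_set_of; exists n|apply/zmem_pair2; left].
Qed.

(** If [u n] and [v n] differ, one is below the other, and then the value of [s]
    is recorded in the code of the larger one and picked out by the code of the
    smaller one. *)
Lemma elementary_separation M u v : elementary_submodel M Hc ->
  M zpts -> M zcuts -> M (zseq u) -> M (zbelow u) -> M (zseq v) -> M (zbelow v) ->
  (forall k, exists2 n, k <= n & u n <> v n) ->
  exists2 f, M (zfun f) &
    forall k, exists n, [/\ k <= n, u n <> v n & f k = s n (u n) (v n)].
Proof.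
move=> elM MP ML Mu Mu' Mv Mv' uv.
pose A k j := exists n, [/\ k <= n, u n <> v n & j = s n (u n) (v n)].
pose G := zset_of [set t : nat * nat | A t.1 t.2] (fun t => zpt t.1 t.2).
have GP z : zmem z G <-> exists k j, z = zpt k j /\ A k j.
  rewrite zmem_set_of; split=> [[[k j] /= Akj ->]|[k [j [-> Akj]]]].
    by exists k, j.
  by exists (k, j).
apply: (@elementary_uniformize M G A) => //; last first.
  by move=> k; have [n kn unv] := uv k; exists (s n (u n) (v n)), n.
have HG : Hc G.
  apply/hcountable_Hc/hcountable_set_of => [|t _]; first exact: countableP.
  exact: hcountable_zpt.
apply: (elementary_link elM Mu' Mv Mv' Mu MP HG) => z; rewrite GP; split.
  move=> [k [j [-> [n [kn unv ->]]]]].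
  have zP : zmem (zpt k (s n (u n) (v n))) zpts.
    by apply/zmem_set_of; exists (k, s n (u n) (v n)).
  split=> //; rewrite !link_below //.
  by have [Ruv|Rvu] := R_total unv; [right|left]; exists n, k; rewrite // s_sym.
move=> [zP]; rewrite !link_below // => -[] [n [k [kn Rr ->]]].
- exists k, (s n (v n) (u n)); split=> //; exists n; rewrite s_sym.
  by split=> // unv; move: Rr; rewrite unv => /R_irr.
exists k, (s n (u n) (v n)); split=> //; exists n.
by split=> // unv; move: Rr; rewrite unv => /R_irr.
Qed.

End Codes.

(** * Increasing unions of closed discrete sets *)

(** In the form with a neighborhood of each point of the whole space, being closed
    discrete visibly passes to subsets, to subspaces and to preimages under
    continuous injections. *)
Lemma closed_discreteP (X : topologicalType) (D : set X) :
  closed_discrete D <->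
  forall y, exists V, [/\ open V, V y & forall w, V w -> D w -> w = y].
Proof.
split=> [[cD dD] y|loc].
  have [/dD[_ [V + VD]]|Dy] := pselect (D y).
    rewrite nbhsE => -[W [oW Wy] WV]; exists W; split=> // w /WV Vw Dw.
    have : (V `&` D) w by [].
    by rewrite VD.
  exists (~` D); split=> //; first exact: closed_openC.
split; last first.
  move=> y Dy; have [V [oV Vy Vone]] := loc y; split; first exact/mem_set.
  exists V; first exact: open_nbhs_nbhs.
  by apply/seteqP; split=> [w [Vw Dw]|_ -> //]; exact: Vone.
rewrite -openC openE => y Dy; have [V [oV Vy Vone]] := loc y.
rewrite /interior nbhsE; exists V => // w Vw Dw; apply: Dy.
by rewrite -(Vone w).
Qed.

(** Let [D a] be the set of points of [E a] not covered by the neighborhoods of the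
    points of the earlier [D b]. Near a point y covered by the neighborhood of
    some d in [D a], no [D c] with c after a has points, and the earlier ones are
    all inside the closed discrete set [E a]. *)
Lemma D_space_increasing_union (X : topologicalType) K (R : rel K)
    (E : K -> set X) : well_order R ->
  (forall a b, R a b -> E a `<=` E b) -> (forall x, exists a, E a x) ->
  (forall a, closed_discrete (E a)) -> D_space X.
Proof.
move=> woR incE covE discE U UP.
pose lt b a := R b a /\ b <> a.
have [D DP] : exists D : K -> set X, forall a x,
    D a x <-> E a x /\ forall b y, lt b a -> D b y -> ~ U y x.
  pose step a (D : forall b, lt b a -> set X) : set X :=
    [set x | E a x /\ forall b y (ba : lt b a), D b ba y -> ~ U y x].
  exists (Fix (well_order_wf woR) (fun=> set X) step) => a x.
  rewrite Fix_eq // => {}a D D' DD'; congr step.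
  by apply/functional_extensionality_dep => b; apply/funext.
have covD x : exists2 d, (\bigcup_a D a) d & U d x.
  have [a Eax] := covE x; have [Dax|nD] := pselect (D a x).
    by exists x; [exists a|case: (UP x)].
  apply: contrapT => no; apply: nD; apply/DP; split=> // b y _ Dby Uyx.
  by apply: no; exists y => //; exists b.
exists (\bigcup_a D a); last first.
  by apply/seteqP; split=> // x _; have [d Dd Udx] := covD x; exists d.
apply/closed_discreteP => y; have [d [a _ Dad] Udy] := covD y.
have [V [oV Vy Vone]] := (closed_discreteP (E a)).1 (discE a) y.
exists (V `&` U d); split=> //; first by apply: openI => //; case: (UP d).
move=> w [Vw Udw] [c _ Dcw]; apply: Vone => //.
have /DP[Ecw Dc] := Dcw.
have [ac|ca] := well_order_total a c woR; last exact: incE ca _ Ecw.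
have [ac_eq|neq] := pselect (a = c); first by rewrite ac_eq.
by case: (Dc a d).
Qed.

Lemma hereditarily_D_increasing_union (X : topologicalType) K (R : rel K)
    (E : K -> set X) : well_order R ->
  (forall a b, R a b -> E a `<=` E b) -> (forall x, exists a, E a x) ->
  (forall a, closed_discrete (E a)) -> hereditarily_D X.
Proof.
move=> woR incE covE discE A.
apply: (@D_space_increasing_union _ K R (fun a => set_val @^-1` E a)) => //.
- by move=> a b ab x; exact: incE.
- by move=> x; have [a] := covE (set_val x); exists a.
move=> a; apply/closed_discreteP => y.
have [V [oV Vy Vone]] := (closed_discreteP (E a)).1 (discE a) (set_val y).
exists (set_val @^-1` V); split=> //; first by exists V.
by move=> w Vw Ew; apply: val_inj; exact: Vone.
Qed.

Lemma hereditarily_D_space (X : topologicalType) : hereditarily_D X -> D_space X.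
Proof.
move=> hD U UP; pose mk (x : X) : set_type [set: X] := exist _ x (mem_setT x).
have [|D /closed_discreteP dD covD] := hD setT (fun x => set_val @^-1` U (set_val x)).
  by move=> x; case: (UP (set_val x)) => oU Ux; split=> //; exists (U (set_val x)).
exists (set_val @` D); last first.
  apply/seteqP; split=> // y _.
  have [x Dx Uxy] : (\bigcup_(x in D) (set_val @^-1` U (set_val x))) (mk y).
    by rewrite covD.
  by exists (set_val x) => //; exists x.
apply/closed_discreteP => y; have [_ [[V oV <-] Vy Vone]] := dD (mk y).
by exists V; split=> // v Vv [w Dw wE]; subst v; rewrite (Vone w).
Qed.

(** * Local bases and finite subcovers *)

Definition local_base (X : topologicalType) (B : X -> nat -> set X) : Prop :=
  [/\ forall x n, open (B x n), forall x n, B x n x,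
      forall x m n, m <= n -> B x n `<=` B x m &
      forall x A, nbhs x A -> exists n, B x n `<=` A].

Lemma first_countable_local_base (X : topologicalType) :
  first_countable X -> exists B, @local_base X B.
Proof.
move=> fcX; have /choice[C CP] x : exists C : nat -> set X,
    (forall n, open (C n) /\ C n x) /\
    forall A, nbhs x A -> exists n, C n `<=` A.
  have [F [cF Fx FA]] := fcX x; have [e eF] := countable_range setT cF.
  exists (fun n => [set y | F (e n) -> (e n)^° y]); split=> [n|A /FA[S FS SA]].
    have [Fen|nF] := pselect (F (e n)); last first.
      split; last by move=> /nF.
    rewrite (_ : mkset _ = setT); first exact: openT.
    by apply/seteqP; split=> // y _ /nF.
    split; last by move=> _; exact: Fx.
    rewrite (_ : mkset _ = (e n)^°); first exact: open_interior.
    by apply/seteqP; split=> y //= /(_ Fen).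
  have [n _ en] := eF S FS; exists n => y /=; rewrite en => /(_ FS).
  by move=> /interior_subset/SA.
exists (fun x n => [set y | forall i, i <= n -> C x i y]); split.
- move=> x; elim=> [|n IH].
    rewrite (_ : mkset _ = C x 0); first by case: (CP x) => /(_ 0)[].
    apply/seteqP; split=> y /=; first exact.
    by move=> Cy i; rewrite leqn0 => /eqP->.
  rewrite (_ : mkset _ = [set y | forall i, i <= n -> C x i y] `&` C x n.+1).
    by apply: openI => //; case: (CP x) => /(_ n.+1)[].
  apply/seteqP; split=> y /=.
    by move=> Cy; split=> [i ile|]; apply: Cy => //; exact: leqW.
  by move=> [Cy Cn] i; rewrite leq_eqVlt => /orP[/eqP->//|]; exact: Cy.
- by move=> x n i _; case: (CP x) => /(_ i)[].
- by move=> x m n mn y Cy i im; apply: Cy; exact: leq_trans mn.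
move=> x A /(CP x).2[n CA]; exists n => y Cy; apply: CA; exact: Cy.
Qed.

Lemma local_base_sep (X : topologicalType) B x y :
  @local_base X B -> hausdorff_space X -> x <> y -> exists n, ~ B x n y.
Proof.
move=> [_ _ _ Bnbhs] /hausdorff_accessible acc /eqP /acc[A [oA /set_mem xA yA]].
have [|n BA] := Bnbhs x A; first exact: open_nbhs_nbhs.
by exists n => /BA; exact: set_mem yA.
Qed.

Lemma compact_subcover (X : topologicalType) (A : set X) (O : X -> set X) :
  compact A -> (forall x, A x -> open (O x) /\ O x x) ->
  exists s : seq X, (forall x, x \in s -> A x) /\
    forall y, A y -> exists2 x, x \in s & O x y.
Proof.
move=> coA OP; have [[x0 _]|A0] := pselect (exists x, A x); last first.
  by exists [::]; split=> // y Ay; case: A0; exists y.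
pose pX : ptopologicalType := HB.pack X (isPointed.Build X x0).
have : cover_compact (A : set pX) by rewrite -(compact_cover pX).
case/(_ X A O) => [x /OP[]//|x Ax|s sA cov]; first by exists x => //; case: (OP x).
by exists (finmap.enum_fset s); split=> [x /sA/set_mem|y /cov[x]] //; exists x.
Qed.

(** * Nabla products *)

Lemma near_ooP (P : nat -> Prop) :
  (\forall n \near \oo, P n) <-> exists N, forall n, N <= n -> P n.
Proof. by split=> [[N _ NP]|[N NP]]; exists N. Qed.

Section Nabla.
Variable X : nat -> topologicalType.

Lemma open_boxP (A : set (box_product X)) :
  open A <-> forall x, A x ->
    exists U, [/\ open_family U, box U x & box U `<=` A].
Proof.
split=> [[F oF <-] x [U FU Ux]|oA].
  by exists U; split=> [|//|y Uy]; [exact: oF|exists U].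
exists [set U | open_family U /\ box U `<=` A] => [U []//|].
apply/seteqP; split=> [x [U [_ UA] Ux]|x /oA[U [oU Ux UA]]]; first exact: UA.
by exists U.
Qed.

Definition nabla_class (x : box_product X) : nabla_product X :=
  (\pi_({eq_quot (eq_star_equiv X)}%qT) x)%qT.

Lemma nabla_classP x y : nabla_class x = nabla_class y <-> \forall n \near \oo, x n = y n.
Proof. by split=> [/eqmodP/asboolP|xy] //; apply/eqmodP/asboolP. Qed.

Lemma nabla_class_surj q : exists x, nabla_class x = q.
Proof. by exists (repr q); rewrite /nabla_class reprK. Qed.

Lemma open_nabla (V : set (nabla_product X)) : open V <-> open (nabla_class @^-1` V).
Proof. by []. Qed.

(** The basic open sets of the nabla product: the set of tails of a box is already
    open in the box product. *)
Lemma nabla_tail (O : forall n, set (X n)) : open_family O ->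
  exists2 V : set (nabla_product X), open V &
    forall x, V (nabla_class x) <-> \forall n \near \oo, O n (x n).
Proof.
move=> oO; pose V : set (nabla_product X) :=
  [set q | exists2 x, nabla_class x = q & \forall n \near \oo, O n (x n)].
have VP x : V (nabla_class x) <-> \forall n \near \oo, O n (x n).
  split=> [[y /nabla_classP yx]|Ox]; last by exists x.
  by apply: filterS2 yx => n ->.
exists V => //; apply/open_nabla/open_boxP => x /VP Ox.
exists (fun n => [set a | O n (x n) -> O n a]); split=> [n|n|y Uy] //.
  have [Oxn|nO] := pselect (O n (x n)).
    by rewrite (_ : mkset _ = O n) //; apply/seteqP; split=> a //=; apply.
  rewrite (_ : mkset _ = setT); first exact: openT.
  by apply/seteqP; split=> // a _ /nO.
by apply/VP; apply: filterS Ox => n; exact: Uy.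
Qed.

End Nabla.

Lemma le_star_monotone (g : nat -> nat) : exists G : nat -> nat,
  (forall m n, m <= n -> G m <= G n) /\ forall n, g n <= G n.
Proof.
exists (fun n => \max_(i < n.+1) g i); split=> [m n mn|n].
  by apply/bigmax_leqP => i _; exact: (leq_bigmax (widen_ord (mn : m.+1 <= n.+1) i)).
exact: (leq_bigmax (ord_max : 'I_n.+1)).
Qed.

Lemma nabla_hereditarily_D (X : nat -> topologicalType) :
  model_hypothesis ->
  (forall n, first_countable (X n)) ->
  (forall n, hausdorff_space (X n)) ->
  (forall n, [set: X n] #<= continuum) ->
  hereditarily_D (nabla_product X).
Proof.
move=> [K [R [H [woR incH covH elH noncof]]]] fcX T2X cX.
have [lt [lt_irr lt_tot lt_small]] := small_initial_segments.
have exB n := cid (first_countable_local_base (fcX n)).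
pose B n := sval (exB n); have BP n : local_base (B n) := svalP (exB n).
have exj n : exists j : X n -> real, injective j.
  by have /pcard_injP[j jinj] := cX n; exists j => x y; apply: jinj; rewrite inE.
pose j n := sval (cid (exj n)); have jinj n : injective (j n) := svalP (cid (exj n)).
(* the separation indices are functions of the codes, extended by 0 to the
   reals that code no point *)
have /choice[s0 s0P] (t : nat * real * real) : exists m, forall x y : X t.1.1,
    j _ x = t.1.2 -> j _ y = t.2 -> x <> y -> ~ B _ x m y.
  case: t => -[n r t] /=.
  have [[x [y [<- <- xy]]]|no] := pselect
    (exists x y : X n, [/\ j n x = r, j n y = t & x <> y]).
    have [m Bxy] := local_base_sep (BP n) (T2X n) xy.
    by exists m => x' y' /jinj-> /jinj->.
  by exists 0 => x y xr yt xy; case: no; exists x, y.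
pose s n r t := maxn (s0 (n, r, t)) (s0 (n, t, r)).
have s_sym n r t : s n r t = s n t r by rewrite /s maxnC.
have sP n (x y : X n) m : x <> y -> s n (j _ x) (j _ y) <= m -> ~ B _ x m y.
  move=> xy sm Bxy; case: (BP n) => _ _ Binc _.
  apply: (s0P (n, j _ x, j _ y) x y) => //=; apply: Binc Bxy.
  by apply: leq_trans sm; exact: leq_maxl.
pose u (x : box_product X) n := j n (x n).
pose coded a x := [/\ H a zpts, H a zcuts, H a (zseq (u x)) &
                      H a (zbelow lt s (u x))].
have codedS a b x : R a b -> coded a x -> coded b x.
  by move=> /incH ab [*]; split; exact: ab.
have coded_ex x : exists a, coded a x.
  have HcH z : Hc z -> exists a, H a z by rewrite -covH => -[a _]; exists a.
  have [a1 H1] := HcH _ (hcountable_Hc hcountable_zpts).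
  have [a2 H2] := HcH _ (hcountable_Hc hcountable_zcuts).
  have [a3 H3] := HcH _ (hcountable_Hc (hcountable_zseq (u x))).
  have [a4 H4] := HcH _ (Hc_zbelow s lt_small (u x)).
  have dir a b : exists2 c, H a `<=` H c & H b `<=` H c.
    by have [/incH ab|/incH ba] := well_order_total a b woR; [exists b|exists a].
  have [b1 ab1 ab2] := dir a1 a2; have [b2 ab3 ab4] := dir a3 a4.
  have [c c1 c2] := dir b1 b2.
  by exists c; split; auto.
pose E a : set (nabla_product X) := [set q | exists2 x, nabla_class x = q & coded a x].
apply: (@hereditarily_D_increasing_union _ K R E) => //.
- by move=> a b ab q [x xq /(codedS _ _ _ ab)]; exists x.
- move=> q; have [x <-] := nabla_class_surj q; have [a ax] := coded_ex x.
  by exists a, x.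
move=> a; apply/closed_discreteP => q; have [y <-] := nabla_class_surj q.
(* the neighborhood of y comes from a model [b] beyond [a] that has the codes
   of y *)
have [b ab by_] : exists2 b, H a `<=` H b & coded b y.
  have [c cy] := coded_ex y.
  have [ac|ca] := well_order_total a c woR; first by exists c => //; exact: incH.
  by exists a => //; exact: codedS cy.
have /existsNP[g gP] := noncof b; have [G [Gmono gG]] := le_star_monotone g.
have [|V oV VP] := @nabla_tail X (fun n => B n (y n) (G n)).
  by move=> n; case: (BP n).
exists V; split=> //.
  by apply/VP; apply: filterE => n; case: (BP n).
move=> _ /[swap] -[x <- ax] /VP /near_ooP[N xN]; apply: contrapT => xy.
have [z1 z2 xs xb] : coded b x by case: ax => *; split; exact: ab.
have [_ _ ys yb] := by_.
have [f Hf fP] : exists2 f, H b (zfun f) & forall k, exists n,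
    [/\ k <= n, u y n <> u x n & f k = s n (u y n) (u x n)].
  apply: (elementary_separation lt_irr lt_tot s_sym (elH b)) => // k.
  apply: contrapT => no; apply: xy; apply/nabla_classP/near_ooP; exists k => n kn.
  apply: contrapT => xyn; apply: no; exists n => // /jinj/esym; exact: xyn.
(* g exceeds f at some late k; at the corresponding n >= k, monotonicity puts
   x n in a neighborhood of y n that separates the two *)
apply: gP; exists f => //; apply/near_ooP; exists N => k Nk.
have [n [kn uyx fk]] := fP k; apply: leq_trans (gG k) _.
rewrite leqNgt; apply/negP => fG.
apply: (sP n (y n) (x n) (G n)).
- by move=> e; apply: uyx; rewrite /u e.
- by rewrite -[s _ _ _]fk; apply: ltnW; apply: leq_trans fG (Gmono _ _ kn).
by apply: xN; exact: leq_trans Nk kn.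
Qed.

(** * Cardinality of compact first countable spaces *)

(** Well-founded trees that code the points obtained from a base point by taking
    limits of sequences ([Node None]) and points that avoid finitely many basic
    neighborhoods ([Node (Some ms)], where [ms] lists the indices of these
    neighborhoods). *)
Inductive tree : Type :=
| Leaf
| Node of option (seq nat) & (nat -> tree).

(** A tree is determined by the labels at the finite paths from its root, which is
    why there are at most c of them. *)
Fixpoint label (t : tree) (s : seq nat) : option (option (seq nat)) :=
  match t, s with
  | Leaf, _ => None
  | Node l f, [::] => Some l
  | Node l f, n :: s' => label (f n) s'
  end.

Lemma label_inj : injective label.
Proof.
elim=> [|l f IH] [|l' f'] // e; try by move/(congr1 (@^~ [::])): e.
congr Node; first by move/(congr1 (@^~ [::])): e => -[].
apply/funext => n; apply: IH; apply/funext => s.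
by move/(congr1 (@^~ (n :: s))): e.
Qed.

Lemma card_le_tree : [set: tree] #<= continuum.
Proof.
apply: card_le_trans (@card_le_subsets (seq nat * option (option (seq nat)))%type).
apply: (card_le_inj (f := fun t p => label t p.1 == p.2)) => // t t' _ _ e.
apply: label_inj; apply/funext => s.
by move/(congr1 (@^~ (s, label t s))): e; rewrite /= eqxx => /esym/eqP.
Qed.

(** Arhangel'skii's theorem in the compact case. The set of all points coded by
    trees is closed under limits of sequences, hence closed. If it missed a
    point p, it would be covered by finitely many basic neighborhoods of its
    points that miss p; but then it contains a point outside of these. *)
Lemma compact_first_countable_card_le (X : topologicalType) :
  compact [set: X] -> first_countable X -> hausdorff_space X ->
  [set: X] #<= continuum.
Proof.
move=> coX fcX T2X; have [[x0 _]|X0] := pselect (exists x : X, True); last first.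
  by apply: (card_le_inj (f := fun _ _ => false)) => // x; case: X0; exists x.
have [B BP] := first_countable_local_base fcX.
have [Bo Bx Binc Bnbhs] := BP.
pose avoid (ms : seq nat) (u : nat -> X) : set X :=
  [set p | forall i, i < size ms -> ~ B (u i) (nth 0 ms i) p].
pose op l (u : nat -> X) := xget x0
  (if l is Some ms then avoid ms u else [set p | u @ \oo --> p]).
pose fix eval t := if t is Node l f then op l (fun n => eval (f n)) else x0.
suff surj p : range eval p.
  apply: card_le_trans card_le_tree; apply: card_le_trans (card_image_le eval _).
  by apply: subset_card_le => p _; exact: surj.
have clF : closed (range eval).
  move=> q clq; have /choice[t tP] n : exists t, B q n (eval t).
    have [|_ [[t _ <-] Bt]] := clq (B q n); last by exists t.
    exact: open_nbhs_nbhs.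
  exists (Node None t) => //=; set u := fun n => eval (t n).
  have uq : u @ \oo --> q.
    move=> A /Bnbhs[n BA]; exists n => // m /= nm.
    by apply: BA; exact: Binc nm _ (tP m).
  have : [set p | u @ \oo --> p] (op None u) by apply: xgetPex; exists q.
  by move=> uop; exact: (cvg_unique T2X uop uq).
have coF := subclosed_compact clF coX (@subsetT _ _).
apply: contrapT => np; have /choice[m mP] x : exists m, x <> p -> ~ B x m p.
  have [->|xp] := pselect (x = p); first by exists 0.
  by have [m] := local_base_sep BP T2X xp; exists m.
have [//|xs [xsF cov]] := compact_subcover (O := fun x => B x (m x)) coF.
have /choice[tau tauP] x : exists t, range eval x -> eval t = x.
  by have [[t _ <-]|nFx] := pselect (range eval x); [exists t|exists Leaf].
pose f i := tau (nth x0 xs i).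
have fE i : i < size xs -> eval (f i) = nth x0 xs i /\ range eval (nth x0 xs i).
  move=> ixs; have Fi : range eval (nth x0 xs i).
    by apply: xsF; exact: mem_nth.
  by split=> //; exact: tauP.
pose q := eval (Node (Some (map m xs)) f).
have /= qP : avoid (map m xs) (fun n => eval (f n)) q.
  apply: (@xgetPex _ x0 (avoid _ _)); exists p => i; rewrite size_map => ixs.
  have [-> Fi] := fE i ixs; rewrite (nth_map x0) //; apply: mP => pE.
  by apply: np; rewrite -pE.
have [x xD' Bq] := cov q (ex_intro2 _ _ _ I erefl).
have ixs : index x xs < size xs by rewrite index_mem.
apply: (qP (index x xs)); rewrite ?size_map //.
by have [-> _] := fE _ ixs; rewrite (nth_map x0) // nth_index.
Qed.

(** * Box products of compact spaces *)

Section BoxOfCompact.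
Variable X : nat -> topologicalType.
Variable B : forall n, X n -> nat -> set (X n).
Hypothesis BP : forall n, local_base (@B n).
Hypothesis coX : forall n, compact [set: X n].
Hypothesis T2X : forall n, hausdorff_space (X n).

(** A form of the tube lemma for the points that agree with [x] from [N] on, which
    form a copy of a finite product of the factors. The induction fixes the
    coordinate [N] of [x] to each of its values, and compactness of the factor
    reduces to finitely many of them. *)
Lemma box_tube N (x : box_product X) (O : box_product X -> set (box_product X)) :
  neighbornet O ->
  exists s : seq (box_product X), exists g : nat -> nat,
    (forall d, d \in s -> forall n, N <= n -> d n = x n) /\
    forall y : box_product X, (forall n, N <= n -> B (x n) (g n) (y n)) ->
      exists2 d, d \in s & O d y.
Proof.
move=> OP; elim: N x => [|N IH] x.
  have [oOx Oxx] := OP x; have [U [oU Ux UO]] := (open_boxP _).1 oOx x Oxx.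
  have /choice[g gP] n : exists m, B (x n) m `<=` U n.
    by case: (BP n) => _ _ _; apply; apply: open_nbhs_nbhs; split.
  exists [:: x], g; split=> [d|y xy]; first by rewrite inE => /eqP->.
  by exists x; [rewrite inE|apply: UO => n; apply: gP; exact: xy].
have /choice[sg sgP] a : exists sg : seq (box_product X) * (nat -> nat),
    (forall d, d \in sg.1 -> forall n, N <= n -> d n = dfwith x N a n) /\
    forall y : box_product X, (forall n, N <= n -> B (dfwith x N a n) (sg.2 n) (y n)) ->
      exists2 d, d \in sg.1 & O d y.
  by have [s [g sg]] := IH (dfwith x N a); exists (s, g).
have [|as_ [_ cov]] := compact_subcover (O := fun a => B a ((sg a).2 N)) (@coX N).
  by case: (BP N).
exists (flatten [seq (sg a).1 | a <- as_]), (fun n => \max_(a <- as_) (sg a).2 n).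
split=> [d /flattenP[_ /mapP[a _ ->] da] n Nn|y yP].
  by rewrite (sgP a).1 // ?dfwithout //; [rewrite neq_ltn Nn|exact: ltnW].
have [a a_as ya] := cov (y N) I.
have [n|d da Ody] := (sgP a).2 y.
  rewrite leq_eqVlt => /orP[/eqP<-|Nn]; first by rewrite dfwithin.
  rewrite dfwithout; last by rewrite neq_ltn Nn.
  case: (BP n) => _ _ Binc _; apply: Binc (yP n Nn).
  exact: leq_bigmax_seq.
by exists d => //; apply/flattenP; exists (sg a).1 => //; apply/mapP; exists a.
Qed.

Lemma box_seq_discrete (s : seq (box_product X)) (y : box_product X) :
  exists V, [/\ open V, V y & forall w, w \in s -> V w -> w = y].
Proof.
elim: s => [|d s [V [oV Vy Vs]]]; first by exists setT; split=> //; exact: openT.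
have [dy|dy] := pselect (d = y).
  by exists V; split=> // w; rewrite inE => /orP[/eqP->|/Vs].
have [n dyn] : exists n, d n <> y n.
  apply: contrapT => no; apply: dy; apply/functional_extensionality_dep => n.
  by apply: contrapT => dyn; apply: no; exists n.
have /eqP/(hausdorff_accessible (@T2X n))[A [oA /set_mem yA dA]] : y n <> d n.
  by move=> /esym.
exists (V `&` [set w | A (w n)]); split=> //.
  apply: openI => //; apply/open_boxP => w Aw.
  exists (dfwith (fun k => [set: X k]) n A); split=> [k|k|v Av].
  - have [e|ne] := eqVneq n k; first by subst k; rewrite dfwithin.
    by rewrite dfwithout //; exact: openT.
  - by have [e|ne] := eqVneq n k; [subst k; rewrite dfwithin|rewrite dfwithout].
  by have := Av n; rewrite dfwithin.
move=> w; rewrite inE => /orP[/eqP-> [_ /= Ad]|/Vs Vw [/Vw]//].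
by have := set_mem dA; case.
Qed.

(** The fibre of [x] is the union over N of the sets of points that agree with [x]
    from N on. The points of the kernel are chosen in stages: stage N adds
    finitely many points outside of the neighborhoods of the earlier ones, so
    that a tube around the N-th set is covered. Each point of the fibre is in a
    neighborhood that later stages avoid, which makes the kernel discrete, and
    the diagonal maximum of the radii [g N] gives a saturated open set. *)
Lemma fibre_kernel (U : box_product X -> set (box_product X)) (x : box_product X) :
  neighbornet U ->
  exists D : set (box_product X), exists V : set (nabla_product X),
  [/\ open V /\ V (nabla_class x), forall d, D d -> nabla_class d = nabla_class x,
      forall y, V (nabla_class y) -> exists2 d, D d & U d y &
      forall y, nabla_class y = nabla_class x ->
        exists W, [/\ open W, W y & forall w, D w -> W w -> w = y]].
Proof.
move=> UP.
have /choice[sg sgP] (NP : nat * seq (box_product X)) :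
    exists sg : seq (box_product X) * (nat -> nat),
    [/\ forall d, d \in sg.1 -> forall n, NP.1 <= n -> d n = x n,
        forall d e, d \in sg.1 -> e \in NP.2 -> ~ U e d &
        forall y : box_product X, (forall n, NP.1 <= n -> B (x n) (sg.2 n) (y n)) ->
          exists2 d, d \in NP.2 ++ sg.1 & U d y].
  case: NP => N P /=; pose C := [set y | exists2 e, e \in P & U e y].
  have oC : open C.
    rewrite (_ : C = \bigcup_(e in [set` P]) U e).
      by apply: bigcup_open => e _; case: (UP e).
    by apply/seteqP; split=> y [e]; exists e.
  (* what is covered already counts as one neighborhood, so that the new points
     can be taken outside of it *)
  pose O d := if `[< C d >] then C else U d.
  have [|s [g [sx sg]]] := @box_tube N x O.
    by move=> d; rewrite /O; case: asboolP => // _; exact: UP.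
  exists ([seq d <- s | `[< ~ C d >]], g); split=> /= [d|d e|y /sg[d ds]].
  - by rewrite mem_filter => /andP[_ /sx].
  - by rewrite mem_filter => /andP[/asboolP nC _] eP Ued; apply: nC; exists e.
  rewrite /O; case: asboolP => [_ [e eP Uey]|nC Udy].
    by exists e; rewrite // mem_cat eP.
  by exists d; rewrite // mem_cat mem_filter ds asboolT // orbT.
(* P N lists the points chosen before stage N, F N those of stage N *)
pose fix P N := if N is N'.+1 then P N' ++ (sg (N', P N')).1 else [::].
pose F N := (sg (N, P N)).1; pose g N := (sg (N, P N)).2.
have PF N d : d \in P N <-> exists2 i, i < N & d \in F i.
  elim: N => [|N IH]; first by split=> [|[]].
  rewrite /= mem_cat; split=> [/orP[/IH[i iN]|dF]|[i]].
  - by exists i => //; exact: leqW.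
  - by exists N.
  rewrite ltnS leq_eqVlt => /orP[/eqP-> ->|iN dF]; first by rewrite orbT.
  by apply/orP; left; apply/IH; exists i.
have FU N (y : box_product X) : (forall n, N <= n -> B (x n) (g N n) (y n)) ->
    exists i, exists2 d, i <= N /\ d \in F i & U d y.
  move=> yP; have [_ _ /(_ y yP)[d]] := sgP (N, P N).
  rewrite mem_cat => /orP[/PF[i iN dF]|dF] Udy.
    by exists i, d => //; split=> //; exact: ltnW.
  by exists N, d.
have [|V oV VP] := @nabla_tail X (fun n => B (x n) (\max_(N < n.+1) g N n)).
  by move=> n; case: (BP n).
exists [set d | exists N, d \in F N], V; split.
- by split=> //; apply/VP; apply: filterE => n; case: (BP n).
- move=> d [N dF]; apply/nabla_classP/near_ooP; exists N.
  by have [/(_ d dF)] := sgP (N, P N).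
- move=> y /VP/near_ooP[N yP]; have [n Nn|i [d [iN dF] Udy]] := FU N y.
    case: (BP n) => _ _ Binc _; apply: Binc (yP n Nn).
    exact: (@leq_bigmax _ (fun i : 'I_n.+1 => g i n) (Ordinal (Nn : N < n.+1))).
  by exists d => //; exists i.
move=> y /nabla_classP/near_ooP[N yx].
have [n Nn|i [d [iN dF] Udy]] := FU N y; first by rewrite yx //; case: (BP n).
have [V' [oV' V'y V's]] := box_seq_discrete (P i.+1) y.
exists (V' `&` U d); split=> //; first by apply: openI => //; case: (UP d).
move=> w [k wF] [V'w Udw]; have [ki|ik] := leqP k i.
  by apply: V's => //; apply/PF; exists k.
have [_ /(_ w d wF) nU _] := sgP (k, P k); exfalso; apply: nU => //.
by apply/PF; exists i.
Qed.

(** The kernels of the fibres over a closed discrete set of classes together form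
    a closed discrete set, because the fibres are separated by preimages of open
    sets. *)
Lemma box_D_space : D_space (nabla_product X) -> D_space (box_product X).
Proof.
move=> DN U UP.
have /choice[DV DVP] (q : nabla_product X) :
    exists DV : set (box_product X) * set (nabla_product X),
    [/\ open DV.2 /\ DV.2 q, forall d, DV.1 d -> nabla_class d = q,
      forall y, DV.2 (nabla_class y) -> exists2 d, DV.1 d & U d y &
      forall y, nabla_class y = q ->
        exists W, [/\ open W, W y & forall w, DV.1 w -> W w -> w = y]].
  by have [x <-] := nabla_class_surj q;
    have [D [V DV]] := fibre_kernel x UP; exists (D, V).
have [|E /closed_discreteP dE covE] := DN (fun q => (DV q).2).
  by move=> q; case: (DVP q).
exists (\bigcup_(q in E) (DV q).1); last first.
  apply/seteqP; split=> // y _.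
  have [q Eq Vy] : (\bigcup_(q in E) (DV q).2) (nabla_class y) by rewrite covE.
  have [_ _ /(_ y Vy)[d Dd Udy] _] := DVP q.
  by exists d => //; exists q.
apply/closed_discreteP => y; have [W [oW Wy Wone]] := dE (nabla_class y).
have [_ _ _ /(_ y erefl)[V [oV Vy Vone]]] := DVP (nabla_class y).
exists (@nabla_class X @^-1` W `&` V); split=> //; first exact: openI.
move=> w [/= Ww Vw] [q Eq Dw]; have [_ /(_ w Dw) wq _ _] := DVP q.
by apply: Vone => //; rewrite -(Wone q) // -wq.
Qed.

End BoxOfCompact.

Theorem proposition26 :
  model_hypothesis ->
  (forall X : nat -> topologicalType,
     (forall n, first_countable (X n)) ->
     (forall n, hausdorff_space (X n)) ->
     (forall n, [set: X n] #<= continuum) ->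
     hereditarily_D (nabla_product X)) /\
  (forall X : nat -> topologicalType,
     (forall n, compact [set: X n]) ->
     (forall n, first_countable (X n)) ->
     (forall n, hausdorff_space (X n)) ->
     D_space (box_product X)).
Proof.
move=> MH; split=> X; first exact: nabla_hereditarily_D.
move=> coX fcX T2X; pose exB n := cid (first_countable_local_base (fcX n)).
apply: (box_D_space (B := fun n => sval (exB n))) => // [n|].
  exact: svalP (exB n).
apply/hereditarily_D_space/nabla_hereditarily_D => // n.
exact: compact_first_countable_card_le.
Qed.
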